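(* Let $G^\sigma$ be a connected oriented unicyclic graph of order $n$ whose unique cycle $C_k^\sigma$ has length $k$, and let $\beta(G^\sigma)$ be its matching number. Then $sr(G^\sigma)=2\beta(G^\sigma)-2$ if $k$ is even, $C_k^\sigma$ is evenly-oriented and $m_{G^\sigma}(\beta(G^\sigma))=2\,m_{G^\sigma-C_k^\sigma}\big(\beta(G^\sigma)-\tfrac{k}{2}\big)$; otherwise $sr(G^\sigma)=2\beta(G^\sigma)$.
   Context: An oriented graph $G^\sigma$ is a simple graph $G$ together with an orientation of each edge. Its skew-adjacency matrix $S(G^\sigma)=(s_{ij})$ has $s_{ij}=1$ if there is an arc from $v_i$ to $v_j$, $s_{ij}=-1$ if there is an arc from $v_j$ to $v_i$, and $0$ otherwise; the skew-rank $sr(G^\sigma)$ is the rank of $S(G^\sigma)$. For an even cycle $u_1\cdots u_ku_1$, its sign is the sign of $\prod_{i=1}^k s_{u_iu_{i+1}}$ ($u_{k+1}=u_1$); the cycle is evenly-oriented if this sign is positive. $m_H(i)$ denotes the number of matchings with exactly $i$ edges in $H$, and $\beta(H)$ the matching number of $H$. $G^\sigma-C_k^\sigma$ is obtained by deleting all vertices of the cycle and their incident edges. *)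

(* Defs.v *)
From mathcomp Require Import all_boot all_order all_algebra.
Set Implicit Arguments. Unset Strict Implicit. Unset Printing Implicit Defensive.
Import Order.TTheory GRing.Theory Num.Theory.

Local Open Scope ring_scope.
Section OrientedGraph.
Variable V : finType.
Variable arc : rel V.

Definition oriented : Prop :=
  (forall u, ~~ arc u u) /\ (forall u v, arc u v -> ~~ arc v u).

Definition adj : rel V := fun u v => arc u v || arc v u.

Definition connected_graph : Prop := forall u v, connect adj u v.

Definition is_edge (e : {set V}) : bool :=
  [exists u, exists v, adj u v && (e == [set u; v])].

Definition is_cycle (c : seq V) : bool :=
  [&& uniq c, (3 <= size c)%N & cycle adj c].

Definition cycle_edges (c : seq V) : {set {set V}} :=
  [set [set x; next c x] | x in c].

Definition unicyclic : Prop :=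
  connected_graph /\
  exists2 c, is_cycle c & forall c', is_cycle c' -> cycle_edges c' = cycle_edges c.

Definition skew_entry (R : nzRingType) (u v : V) : R :=
  if arc u v then 1 else if arc v u then -1 else 0.

Definition skew_adj (R : nzRingType) : 'M[R]_#|V| :=
  \matrix_(i, j) skew_entry R (enum_val i) (enum_val j).

Definition skew_rank (R : fieldType) : nat := \rank (skew_adj R).

Definition cycle_sign (c : seq V) : int :=
  \prod_(x <- c) skew_entry int x (next c x).

Definition evenly_oriented (c : seq V) : bool := cycle_sign c > 0.

Definition matching (M : {set {set V}}) : bool :=
  [forall e in M, is_edge e] &&
  [forall e in M, forall f in M, (e != f) ==> [disjoint e & f]].

Definition num_matchings (i : nat) : nat :=
  #|[set M : {set {set V}} | matching M & #|M| == i]|%N.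

Definition matching_number : nat :=
  (\max_(M : {set {set V}} | matching M) #|M|)%N.

(* m_{G - C}(i): matchings of the graph obtained by deleting the vertex set C,
   i.e. matchings of G all of whose edges avoid C *)
Definition num_matchings_del (C : {set V}) (i : nat) : nat :=
  #|[set M : {set {set V}} | [&& matching M,
        [forall e in M, [disjoint e & C]] & #|M| == i]]|%N.

End OrientedGraph.

(* Main.v *)
Require Import Defs.
From mathcomp Require Import all_boot all_order all_algebra.
From mathcomp Require Import zify ring.
Import Order.TTheory GRing.Theory Num.Theory.
Set Implicit Arguments. Unset Strict Implicit. Unset Printing Implicit Defensive.

(** For k even, a matching of G - C of size beta - k/2 extends by either of the
    two perfect matchings of C to a maximum matching of G.  Hence
    m_G(beta) = 2 m_{G-C}(beta - k/2) holds iff every maximum matching of G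
    contains a perfect matching of C.  This condition, the rank and the matching
    number behave well when the neighbour u of a leaf v is deleted: the rank drops
    by 2 and the matching number by 1; if u is off C the condition is unchanged,
    and if u is on C the condition fails (extend a maximum matching of G - u by uv)
    while G - u is a forest.  When all cycles have the same edge set and some edge
    lies off it, a leaf exists, because a maximal path through that edge would
    otherwise close up into a cycle at each end.  So one is reduced to a bare
    cycle, where the kernel of S can be computed: after rescaling by partial
    products of signs, kernel vectors are 2-periodic. *)

(** * Leaves *)

Section Graph.
Variables (V : finType) (arc : rel V).
Implicit Types (u v w x y : V) (c p : seq V).

Definition leaf v u := [forall w, adj arc v w == (w == u)].

Lemma leaf_adj v u w : leaf v u -> adj arc v w = (w == u).
Proof. by move/forallP/(_ w)/eqP. Qed.

Lemma adj_sym : symmetric (adj arc).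
Proof. by move=> u v; rewrite /adj orbC. Qed.

Lemma is_cycle_rot n c : is_cycle arc (rot n c) = is_cycle arc c.
Proof. by rewrite /is_cycle rot_uniq size_rot rot_cycle. Qed.

Lemma cycle_edgesP c e :
  reflect (exists2 x, x \in c & e = [set x; next c x]) (e \in cycle_edges c).
Proof. exact: imsetP. Qed.

Lemma cycle_edge_sub c e x : e \in cycle_edges c -> x \in e -> x \in c.
Proof.
by case/imsetP=> y yc ->; rewrite !inE => /orP[] /eqP->; rewrite ?mem_next.
Qed.

Lemma mem_cycle_edge c x : x \in c -> [set x; next c x] \in cycle_edges c.
Proof. by move=> xc; apply/imsetP; exists x. Qed.

(** On a cycle of length at least 3 the two cycle neighbours of a vertex are distinct, whereas both
    would be [u] here. *)
Lemma leaf_notin_cycle v u c : leaf v u -> is_cycle arc c -> v \notin c.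
Proof.
move=> lf cc; apply/negP=> vc; have [i s rc] := rot_to vc.
move: cc; rewrite -(is_cycle_rot i) rc.
case: s {rc} => [|x [|y s]] //; first by rewrite /is_cycle andbF.
case/and3P=> [uc _]; rewrite (cycle_path v) /=.
rewrite adj_sym (leaf_adj _ lf) (leaf_adj _ lf).
case/and3P=> /eqP lu /eqP xu _; move: uc; rewrite xu -lu /=.
by rewrite mem_last !andbF.
Qed.

Hypothesis irr : irreflexive (adj arc).

(** The path runs from the end of [p1] through [u] and [w] to the end of [p2]. This last vertex is
    not a leaf, so it has a neighbour besides its predecessor, and that neighbour lies on the path.
    The edge to it closes a cycle, which either crosses [uw] or stays within [w :: p2]. *)
Lemma branch_cycle u p1 w p2 :
  adj arc u w -> path (adj arc) u p1 -> path (adj arc) w p2 ->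
  uniq ((u :: p1) ++ (w :: p2)) ->
  (forall y, adj arc (last w p2) y -> y \in (u :: p1) ++ (w :: p2)) ->
  (forall x, ~~ leaf (last w p2) x) ->
  exists2 c, is_cycle arc c &
    [set u; w] \in cycle_edges c \/ {subset c <= w :: p2}.
Proof.
move=> uw up1 wp2 U mx nl.
(* [q] is the predecessor of the last vertex; it is [u] when [p2] is empty. *)
pose q := last u (belast w p2).
have aq : adj arc (last w p2) q.
  rewrite /q; case/lastP: (p2) wp2 => [|s z] /=; first by rewrite adj_sym.
  by rewrite rcons_path last_rcons belast_rcons adj_sym => /andP[].
have [y ay yq] : exists2 y, adj arc (last w p2) y & y != q.
  have /forallPn[y] := nl q; case: (eqVneq y q) => [->|yq].
    by rewrite aq.
  by case ay: (adj _ _ _) => // _; exists y.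
have yz : y != last w p2 by apply: contraTneq ay => ->; rewrite irr.
rewrite {}/q in aq yq; have := mx y ay; rewrite mem_cat => /orP[yp|yp].
- move: up1 U; rewrite /=; case/splitPl: yp => a b lay.
  rewrite cat_path => /andP[ua _] U.
  have {}U : uniq ((u :: a) ++ rev (w :: p2)).
    have {}U : uniq (((u :: a) ++ b) ++ (w :: p2)) by [].
    move: U; rewrite -catA uniq_catCA cat_uniq => /and3P[_ _].
    by rewrite !cat_uniq rev_uniq => /and3P[-> h ->]; rewrite andbT has_rev in h *.
  (* Here [y] is on the side of [u]: go from [u] along [a] to [y], jump to the end of [p2], and come
     back to [w], which is adjacent to [u]. *)
  have cyc : is_cycle arc ((u :: a) ++ rev (w :: p2)).
    apply/and3P; split=> //.
      rewrite size_cat size_rev /= addSn !addnS !ltnS addn_gt0.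
      by case: (a) (p2) lay yq => [|? ?] [|? ?] //= ->; rewrite eqxx.
    rewrite (cycle_path u) cat_cons /= last_cat rev_cons last_rcons adj_sym uw /=.
    rewrite cat_path ua lay -rev_cons /=.
    rewrite lastI rev_rcons /= adj_sym ay /=.
    by rewrite (eq_path (e' := fun x z => adj arc z x)) ?rev_path // => ? ?; rewrite adj_sym.
  exists ((u :: a) ++ rev (w :: p2)) => //; left.
  have nu : next ((u :: a) ++ rev (w :: p2)) w = u.
    have -> : (u :: a) ++ rev (w :: p2) = rcons ((u :: a) ++ rev p2) w.
      by rewrite rev_cons -rcons_cat.
    rewrite -(next_rotr 1).
      rewrite rotr1_rcons /= eqxx //.
    by move: U; rewrite rev_cons -rcons_cat.
  rewrite setUC -{1}nu mem_cycle_edge // mem_cat mem_rev mem_head orbT //.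
(* Here [y] is on the side of [w]: the segment from [y] to the end closes up. It has at least 3
   vertices because [y] is neither the end nor its predecessor. *)
- move: wp2 U yz yq ay; case/splitPl: yp => a b lay.
  rewrite cat_path last_cat belast_cat last_cat lay => /andP[_ yb] U yz yq ay.
  exists (y :: b); last first.
    right=> x; rewrite -cat_cons mem_cat inE => /orP[/eqP->|->]; last by rewrite orbT.
    by rewrite -lay mem_last.
  apply/and3P; split.
  - move: U; rewrite cat_uniq -cat_cons => /and3P[_ _]; rewrite lastI lay cat_uniq.
    case/and3P=> _ h /= ->; rewrite andbT.
    apply: contra h => yb'; apply/hasP; exists y => //; rewrite mem_rcons mem_head //.
  - by case: (b) yz yq => [|? [|? ?]] //=; rewrite eqxx.
  - by rewrite (cycle_path y) /= ay yb.
Qed.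

(** Extend a path through [uw] at both ends until it is maximal. Without leaves, [branch_cycle]
    gives a cycle at each end; as [uw] is not in [E], each cycle stays in its own half. Having the
    same edges, the two cycles would share a vertex, but the halves are disjoint. *)
Lemma exists_leaf (E : {set {set V}}) u w :
  (forall c, is_cycle arc c -> cycle_edges c = E) -> adj arc u w ->
  [set u; w] \notin E -> exists v x, leaf v x.
Proof.
move=> allE uw nE.
have [/existsP[v /existsP[x lf]]|/existsPn nl] := boolP [exists v, [exists x, leaf v x]].
  by exists v, x.
have {}nl v x : ~~ leaf v x by move: (nl v) => /existsPn.
(* [n] bounds the number of extensions still possible, since a path without repetition has at most
   [#|V|] vertices. *)
suff H n p1 p2 : #|V| < n + size ((u :: p1) ++ (w :: p2)) ->
    path (adj arc) u p1 -> path (adj arc) w p2 ->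
    uniq ((u :: p1) ++ (w :: p2)) -> False.
  have uNw : u != w by apply: contraTneq uw => ->; rewrite irr.
  case: (@H #|V| [::] [::]) => //=; first by lia.
  by rewrite inE uNw.
elim: n p1 p2 => [|n IH] p1 p2.
  by move=> + _ _ /card_uniqP us; rewrite add0n -us ltnNge max_card.
move=> lt P1 P2 U.
have [/existsP[y /andP[ay yn]]|/existsPn m2] :=
  boolP [exists y, adj arc (last w p2) y && (y \notin (u :: p1) ++ (w :: p2))].
  apply: (IH p1 (rcons p2 y)); rewrite -?rcons_cons -?rcons_cat ?size_rcons //; first lia.
    by rewrite rcons_path P2.
  by rewrite rcons_uniq yn U.
have [/existsP[y /andP[ay yn]]|/existsPn m1] :=
  boolP [exists y, adj arc (last u p1) y && (y \notin (u :: p1) ++ (w :: p2))].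
  apply: (IH (rcons p1 y) p2) => //.
  - by move: lt; rewrite !size_cat /= size_rcons; lia.
  - by rewrite rcons_path P1.
  by rewrite uniq_catC -rcons_cons -rcons_cat rcons_uniq uniq_catC U mem_cat orbC -mem_cat yn.
have [|c1 cc1] := branch_cycle uw P1 P2 U _ (nl _).
- by move=> y ay; have := m2 y; rewrite ay negbK.
case; first by rewrite allE // => h; rewrite h in nE.
move=> s1.
have U' : uniq ((w :: p2) ++ (u :: p1)) by rewrite uniq_catC.
have wu : adj arc w u by rewrite adj_sym.
have [|c2 cc2] := branch_cycle wu P2 P1 U' _ (nl _).
- by move=> y ay; have := m1 y; rewrite ay mem_cat orbC -mem_cat negbK.
case; first by rewrite setUC allE // => h; rewrite h in nE.
move=> s2.
(* A vertex [x] of [c1] is on an edge of [c1], which is also an edge of [c2]; so [x] is in both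
   halves. *)
case/and3P: (cc1) => _; case E1: c1 => [//|x s] _ _.
have xc1 : x \in c1 by rewrite E1 mem_head.
have := mem_cycle_edge xc1; rewrite allE // -(allE _ cc2) => /cycle_edge_sub/(_ (set21 _ _)).
move=> /s2 xs; have := s1 _ xc1 => xt.
move: U; rewrite cat_uniq => /and3P[_ /hasP[]]; exists x => //.
Qed.
End Graph.

(** * Matchings and vertex deletion *)

Section Matchings.
Variables (V : finType) (arc : rel V).
Implicit Types (u v w x y : V) (e f : {set V}) (M N : {set {set V}}).

Lemma matchingP M :
  reflect ((forall e, e \in M -> is_edge arc e) /\
           {in M &, forall e f x, x \in e -> x \in f -> e = f}) (matching arc M).
Proof.
apply: (iffP andP) => [[/forall_inP ed /forall_inP dj]|[ed dj]]; split=> //.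
- move=> e f eM fM x xe xf; apply/eqP; apply: contraT => ef.
  by have /forall_inP/(_ f fM)/implyP/(_ ef) := dj e eM; move/disjointFr/(_ xe); rewrite xf.
- exact/forall_inP.
- apply/forall_inP=> e eM; apply/forall_inP=> f fM; apply/implyP=> ef.
  rewrite disjoint_subset; apply/subsetP=> x xe; rewrite inE.
  by apply: contra ef => xf; rewrite (dj e f eM fM x).
Qed.

Lemma is_edgeP e :
  reflect (exists u v, adj arc u v /\ e = [set u; v]) (is_edge arc e).
Proof.
apply: (iffP existsP) => [[u /existsP[v /andP[uv /eqP->]]]|[u [v [uv ->]]]].
  by exists u, v.
by exists u; apply/existsP; exists v; rewrite uv eqxx.
Qed.

Lemma matching0 : matching arc set0.
Proof. by apply/matchingP; split=> [e|e f]; rewrite inE. Qed.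

Lemma matching_sub M N : M \subset N -> matching arc N -> matching arc M.
Proof.
move=> /subsetP s /matchingP[ed dj]; apply/matchingP; split.
  by move=> e /s; apply: ed.
by move=> e f /s eN /s fN; apply: dj.
Qed.

Lemma leq_matching_number M : matching arc M -> #|M| <= matching_number arc.
Proof. by move=> m; rewrite /matching_number (leq_bigmax_cond M). Qed.

Lemma ex_maximum_matching : exists2 M, matching arc M & #|M| = matching_number arc.
Proof.
have ne : 0 < #|[pred M | matching arc M]|.
  by apply/card_gt0P; exists set0; exact: matching0.
by have [M m e] := eq_bigmax_cond (fun M : {set {set V}} => #|M|) ne; exists M.
Qed.

Lemma matchingU1 M e : is_edge arc e -> matching arc M ->
  (forall f x, f \in M -> x \in e -> x \notin f) -> matching arc (e |: M).
Proof.
move=> ee /matchingP[ed dj] h; apply/matchingP; split.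
  by move=> f; rewrite !inE => /orP[/eqP->|/ed].
move=> f g; rewrite !inE => /orP[/eqP->|fM] /orP[/eqP->|gM] x //.
- by move=> /(h g x gM)/negPf->.
- by move=> xf /(h f x fM); rewrite xf.
- exact: dj.
Qed.

End Matchings.

Section Deletion.
Variables (V : finType).
Implicit Types (arc : rel V) (u v w x y : V) (e f : {set V}) (M N : {set {set V}}).

(** The vertex remains as an isolated one, so that the vertex type and the size of the
    skew-adjacency matrix do not change. *)
Definition del_vertex arc u : rel V := fun a b => [&& arc a b, a != u & b != u].

Lemma adj_del arc u a b :
  adj (del_vertex arc u) a b = [&& adj arc a b, a != u & b != u].
Proof.
by rewrite /adj /del_vertex; case: (arc a b) (arc b a) (a != u) (b != u) => [] [] [] [].
Qed.

Lemma oriented_del arc u : oriented arc -> oriented (del_vertex arc u).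
Proof.
case=> irr anti; split=> [a|a b]; first by rewrite /del_vertex (negPf (irr a)).
by case/and3P=> /anti h _ _; rewrite /del_vertex (negPf h).
Qed.

Lemma is_edge_del arc u e :
  is_edge (del_vertex arc u) e = is_edge arc e && (u \notin e).
Proof.
apply/is_edgeP/andP=> [[a [b [ab ->]]]|[/is_edgeP[a [b [ab ->]]] ue]].
  move: ab; rewrite adj_del => /and3P[ab au bu]; split.
    by apply/is_edgeP; exists a, b.
  by rewrite !inE negb_or eq_sym au eq_sym.
exists a, b; split=> //; rewrite adj_del ab.
by move: ue; rewrite !inE negb_or eq_sym [u == b]eq_sym.
Qed.

Lemma matching_del arc u M :
  matching (del_vertex arc u) M = matching arc M && [forall e in M, u \notin e].
Proof.
apply/matchingP/andP=> [[ed dj]|[/matchingP[ed dj] /forall_inP uM]].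
  split; last by apply/forall_inP=> e /ed; rewrite is_edge_del => /andP[].
  by apply/matchingP; split=> // e /ed; rewrite is_edge_del => /andP[].
by split=> // e eM; rewrite is_edge_del ed // uM.
Qed.

(* [E0] and [E1] stand for the two perfect matchings of the cycle. *)
Definition maximum_forced arc (E0 E1 : {set {set V}}) :=
  [forall M : {set {set V}}, matching arc M && (#|M| == matching_number arc) ==>
     (E0 \subset M) || (E1 \subset M)].

Section Leaf.
Variables (arc : rel V) (v u : V).
Hypothesis lf : leaf arc v u.

Lemma leaf_adj_stem : adj arc v u.
Proof. by rewrite (leaf_adj _ lf). Qed.

Lemma leaf_edge e : is_edge arc e -> v \in e -> e = [set v; u].
Proof.
case/is_edgeP=> a [b [ab ->]]; rewrite !inE => /orP[] /eqP vE; subst.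
  by move: ab; rewrite (leaf_adj _ lf) => /eqP->.
by move: ab; rewrite adj_sym (leaf_adj _ lf) => /eqP->; rewrite setUC.
Qed.

(** The only edge at [v] is [vu], so a matching that avoids [u] avoids [v] as well and leaves room
    for this edge. *)
Lemma matching_add_leaf M : matching (del_vertex arc u) M ->
  matching arc ([set v; u] |: M) /\ #|[set v; u] |: M| = #|M|.+1.
Proof.
rewrite matching_del => /andP[mM /forall_inP uM]; have [ed _] := matchingP _ _ mM.
split; last by rewrite cardsU1; case: (boolP (_ \in M)) => // /uM; rewrite set22.
apply: matchingU1 => //.
  by apply/is_edgeP; exists v, u; split=> //; exact: leaf_adj_stem.
move=> f x fM; rewrite !inE => /orP[] /eqP-> ; last exact: uM.
apply/negP=> vf; have := uM f fM.
by rewrite (leaf_edge (ed f fM) vf) set22.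
Qed.

(** At most one edge of a matching covers [u]. *)
Lemma matching_remove_stem M : matching arc M ->
  matching (del_vertex arc u) [set e in M | u \notin e] /\
  #|M| <= #|[set e in M | u \notin e]|.+1.
Proof.
move=> mM; have [_ dj] := matchingP _ _ mM; split.
  rewrite matching_del (matching_sub _ mM).
    by apply/forall_inP=> e; rewrite inE => /andP[].
  by apply/subsetP=> e; rewrite inE => /andP[].
rewrite -(cardsID [set e : {set V} | u \in e] M) -addn1 addnC leq_add //.
  by rewrite subset_leq_card //; apply/subsetP=> e; rewrite !inE andbC.
apply/card_le1P; rewrite /mem /= => e; rewrite !inE => /andP[eM ue] f.
apply/idP/eqP => [|->]; rewrite !inE ?eM // => /andP[fM uf].
exact: dj fM eM u uf ue.
Qed.

Lemma matching_number_leaf :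
  matching_number arc = (matching_number (del_vertex arc u)).+1.
Proof.
apply/eqP; rewrite eqn_leq; apply/andP; split.
  have [M mM <-] := ex_maximum_matching arc.
  have [m' le] := matching_remove_stem mM.
  by apply: leq_trans le _; rewrite ltnS leq_matching_number.
have [M mM <-] := ex_maximum_matching (del_vertex arc u).
by have [m' <-] := matching_add_leaf mM; apply: leq_matching_number.
Qed.

(** Adding [vu] turns maximum matchings of [G - u] into maximum matchings of [G], and dropping the
    edge at [u] goes back. The edges of [E0] and [E1] avoid [u], so the inclusions carry over. *)
Lemma maximum_forced_leaf E0 E1 :
  (forall e, e \in E0 :|: E1 -> u \notin e) ->
  maximum_forced arc E0 E1 = maximum_forced (del_vertex arc u) E0 E1.
Proof.
move=> uE; apply/forallP/forallP => H M; apply/implyP=> /andP[mM /eqP sM].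
  have [m' s'] := matching_add_leaf mM.
  move: (H ([set v; u] |: M)); rewrite m' s' sM matching_number_leaf eqxx /=.
  have key (E : {set {set V}}) :
      E \subset E0 :|: E1 -> E \subset [set v; u] |: M -> E \subset M.
    move=> EE /subsetP sE; apply/subsetP=> e eE; move: (sE e eE); rewrite inE => /orP[]//.
    by rewrite inE => /eqP eE2; have := uE e (subsetP EE e eE); rewrite eE2 set22.
  by case/orP=> /key->; rewrite ?orbT ?subsetUl ?subsetUr.
have [m' le] := matching_remove_stem mM.
have := H [set e in M | u \notin e]; rewrite m' /=.
have -> /= : #|[set e in M | u \notin e]| == matching_number (del_vertex arc u).
  rewrite eqn_leq leq_matching_number //=.
  by move: le; rewrite sM matching_number_leaf ltnS.
have s : [set e in M | u \notin e] \subset M by apply/subsetP=> e; rewrite inE => /andP[].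
by case/orP=> /subset_trans/(_ s)->; rewrite ?orbT.
Qed.

(** Extend a maximum matching of [G - u] by [vu]: its only edge at [u] is [vu], so it misses both
    [e0] and [e1]. These will be the two cycle edges at [u]. *)
Lemma maximum_forced_stem (E0 E1 : {set {set V}}) e0 e1 :
  e0 \in E0 -> e1 \in E1 -> u \in e0 -> u \in e1 -> v \notin e0 -> v \notin e1 ->
  ~~ maximum_forced arc E0 E1.
Proof.
move=> e0E e1E ue0 ue1 ve0 ve1; apply/negP=> /forallP H.
have [M mM sM] := ex_maximum_matching (del_vertex arc u).
have [m' s'] := matching_add_leaf mM.
have := H ([set v; u] |: M); rewrite m' s' sM matching_number_leaf eqxx /=.
move: mM; rewrite matching_del => /andP[_ /forall_inP uM].
have key e : u \in e -> v \notin e -> e \notin [set v; u] |: M.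
  move=> ue ve; rewrite !inE; apply/norP; split.
    by apply: contraNneq ve => ->; rewrite set21.
  by apply: contraL ue => /uM.
by case/orP=> /subsetP h; [have := h _ e0E | have := h _ e1E]; apply/negP; apply: key.
Qed.

End Leaf.
End Deletion.

(** * Rank and leaves *)

Section RankLeaf.
Local Open Scope ring_scope.
Variables (R : fieldType) (V : finType).
Implicit Types (arc : rel V) (u v : V).

Lemma oriented_irr arc : oriented arc -> irreflexive (adj arc).
Proof. by case=> irr _ u; rewrite /adj (negPf (irr u)). Qed.

Lemma skew_entryC arc u v : oriented arc ->
  skew_entry arc R u v = - skew_entry arc R v u.
Proof.
case=> irr anti; rewrite /skew_entry.
have := anti u v; case: (arc u v) => [/(_ isT)/negPf->|_]; first by rewrite opprK.
by case: (arc v u); rewrite ?opprK ?oppr0.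
Qed.

Lemma skew_entry_eq0 arc u v : (skew_entry arc R u v == 0) = ~~ adj arc u v.
Proof.
rewrite /skew_entry /adj; case: (arc u v) => /=; first by rewrite oner_eq0.
by case: (arc v u) => /=; rewrite ?oppr_eq0 ?oner_eq0 ?eqxx.
Qed.

Lemma skew_entry_sqr arc u v : adj arc u v ->
  skew_entry arc R u v * skew_entry arc R u v = 1.
Proof.
by rewrite /skew_entry /adj; case: (arc u v) => [_|/= ->]; rewrite ?mulrNN mul1r.
Qed.

Lemma skew_entry_del arc u a b : skew_entry (del_vertex arc u) R a b =
  if (a != u) && (b != u) then skew_entry arc R a b else 0.
Proof.
by rewrite /skew_entry /del_vertex; case: (a != u); case: (b != u); rewrite ?andbT ?andbF.
Qed.

(** Row [v] is supported at column [u], so it spans the line of the unit vector [d]. Modulo [d],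
    every row other than row [u] agrees with its row in [S']. Hence the row space of [S] is the
    direct sum of that of [S'], the line of row [u], called [r], and the line of [d]. *)
Lemma skew_rank_leaf arc v u : oriented arc -> leaf arc v u ->
  skew_rank arc R = (skew_rank (del_vertex arc u) R).+2.
Proof.
move=> ori lf; have irr := oriented_irr ori.
rewrite /skew_rank.
set S := skew_adj arc R; set S' := skew_adj _ R.
pose iu := enum_rank u; pose iv := enum_rank v.
have vu : adj arc v u by rewrite (leaf_adj _ lf).
pose d : 'rV[R]_#|V| := delta_mx 0 iu; pose r := row iu S.
have SE i j : S i j = skew_entry arc R (enum_val i) (enum_val j) by rewrite mxE.
have S'E i j : S' i j = if (i != iu) && (j != iu) then S i j else 0.
  rewrite !mxE skew_entry_del.
  by rewrite -(inj_eq enum_rank_inj) -[in X in _ && X](inj_eq enum_rank_inj) !enum_valK.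
have Siv j : S iv j = (j == iu)%:R * S iv iu.
  have [->|ne] := eqVneq j iu; first by rewrite mul1r.
  rewrite mul0r SE; apply/eqP; rewrite skew_entry_eq0 enum_rankK (leaf_adj _ lf).
  by apply: contra ne => /eqP uE; rewrite /iu -uE enum_valK.
have Snz : S iv iu != 0 by rewrite SE skew_entry_eq0 negbK !enum_rankK.
have Sru : S iu iv != 0 by rewrite SE skew_entry_eq0 negbK !enum_rankK adj_sym.
have Suu : S iu iu = 0 by apply/eqP; rewrite SE skew_entry_eq0 irr.
have vNu : iv != iu by apply: contra Snz => /eqP->; rewrite Suu.
have rowE i : i != iu -> row i S = row i S' + S i iu *: d.
  move=> iNu; apply/rowP=> j; rewrite mxE [RHS]mxE [X in X + _]mxE S'E iNu /= !mxE eqxx /=.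
  by have [->|ne] := eqVneq j iu; rewrite ?add0r ?mulr1 // mulr0 addr0.
have dS : (d <= S)%MS.
  have -> : d = (S iv iu)^-1 *: row iv S.
    have rowiv j : row iv S 0 j = S iv j by rewrite mxE.
    by apply/rowP=> j; rewrite [RHS]mxE rowiv (Siv j) mulrCA mulVf // mulr1 mxE eqxx.
  by rewrite scalemx_sub // row_sub.
have eS : (S :=: S' + (r + d))%MS.
  apply/eqmxP/andP; split.
    apply/row_subP=> i; have [->|ne] := eqVneq i iu.
      by rewrite (submx_trans (addsmxSl r d)) // addsmxSr.
    rewrite rowE // addmx_sub //; first by rewrite (submx_trans (row_sub _ _)) // addsmxSl.
    by rewrite scalemx_sub // (submx_trans (addsmxSr r d)) // addsmxSr.
  rewrite !addsmx_sub row_sub dS !andbT; apply/row_subP=> i.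
  have [->|ne] := eqVneq i iu.
    have -> : row iu S' = 0 by apply/rowP=> j; rewrite mxE S'E eqxx [RHS]mxE.
    exact: sub0mx.
  have -> : row i S' = row i S + (- S i iu) *: d by rewrite (rowE i ne) scaleNr addrK.
  by apply: addmx_sub; [exact: row_sub | exact: scalemx_sub].
(* At [v] the vector [r] is nonzero and [d] is zero, which kills the coefficient of [r]; the entry
   at [u] then kills that of [d]. *)
have rd0 (x : 'rV_#|V|) : x 0 iu = 0 -> x 0 iv = 0 -> (x <= r + d)%MS -> x = 0.
  move=> xu xv /sub_addsmxP[[a b] /= xE].
  have xj j : x 0 j = a 0 0 * S iu j + b 0 0 * (j == iu)%:R.
    by rewrite xE !mxE !big_ord1 !mxE eqxx.
  have a0 : a 0 0 = 0.
    by apply/eqP; move: xv; rewrite xj (negPf vNu) mulr0 addr0 => /eqP;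
      rewrite mulf_eq0 (negPf Sru) orbF.
  have b0 : b 0 0 = 0 by move: xu; rewrite xj eqxx Suu mulr0 add0r mulr1.
  by apply/rowP=> j; rewrite xj a0 b0 !mul0r addr0 mxE.
(* The rows of [S'] vanish at [u], whose column was cleared, and at [v], whose only neighbour was
   [u]. *)
have cap1 : (S' :&: (r + d))%MS = 0.
  apply/eqP; rewrite -submx0; apply/row_subP=> i; set x := row i _.
  have xS' : (x <= S')%MS by rewrite (submx_trans (row_sub _ _)) // capmxSl.
  have xrd : (x <= r + d)%MS by rewrite (submx_trans (row_sub _ _)) // capmxSr.
  have [y xE] := submxP xS'.
  rewrite (rd0 x) ?sub0mx // xE mxE big1 // => k _; rewrite S'E ?eqxx ?andbF ?mulr0 //.
  case: (eqVneq k iu) => [_|kNu] /=; rewrite ?mulr0 // vNu.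
  rewrite SE skew_entryC // -SE Siv (negPf kNu) mul0r.
  by rewrite oppr0 mulr0.
(* [r] vanishes at [u] and [d] vanishes at [v], so a common multiple vanishes at both. *)
have cap2 : (r :&: d)%MS = 0.
  apply/eqP; rewrite -submx0; apply/row_subP=> i; set x := row i _.
  have /sub_rVP[a xr] : (x <= r)%MS by rewrite (submx_trans (row_sub _ _)) // capmxSl.
  have /sub_rVP[b xd] : (x <= d)%MS by rewrite (submx_trans (row_sub _ _)) // capmxSr.
  rewrite (rd0 x) ?sub0mx //; first by rewrite xr !mxE -SE Suu mulr0.
    by rewrite xd !mxE (negPf vNu) andbF mulr0.
  by rewrite xr scalemx_sub // addsmxSl.
have rN0 : r != 0.
  apply/eqP=> r0; move: Sru; have -> : S iu iv = r 0 iv by rewrite [RHS]mxE.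
  by rewrite r0 mxE eqxx.
have dN0 : d != 0 by apply/eqP=> /rowP/(_ iu)/eqP; rewrite !mxE !eqxx oner_eq0.
by rewrite eS mxrank_disjoint_sum // mxrank_disjoint_sum // !rank_rV rN0 dN0 addn2.
Qed.

End RankLeaf.

(** * Rank of a signed cycle *)

Section CycleRank.
Local Open Scope ring_scope.
Variables (R : realFieldType) (k : nat) (s : 'I_k -> R).
Hypothesis k_gt1 : (1 < k)%N.
Hypothesis s_sqr : forall i, s i * s i = 1.

(** The skew-adjacency matrix of a cycle whose step from [i] to [ordS i] has sign [s i]. Written as
    a difference, it needs no case distinction when a row vector is multiplied by it. *)
Definition cycle_mx : 'M[R]_k :=
  \matrix_(i, j) ((j == ordS i)%:R * s i - (i == ordS j)%:R * s j).

Let k_gt0 : (0 < k)%N := ltnW k_gt1.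
(** Positions are indexed by all natural numbers modulo [k], so that inductions can run past the end
    of the cycle. *)
Let o m : 'I_k := Ordinal (ltn_pmod m k_gt0).

Let oS m : ordS (o m) = o m.+1.
Proof. by apply: val_inj; rewrite /= -addn1 modnDml addn1. Qed.

Let oDk m : o (m + k) = o m.
Proof. by apply: val_inj; rewrite /= modnDr. Qed.

Let o_val (i : 'I_k) : o i = i.
Proof. by apply: val_inj; rewrite /= modn_small. Qed.

(** The index may exceed [k]: then [T (m + k) = T k * T m], where [T k] is the product of all
    signs. *)
Definition partial_sign m : R := \prod_(i < m) s (o i).
Local Notation T := partial_sign.

Let TS m : T m.+1 = T m * s (o m).
Proof. exact: big_ord_recr. Qed.

Let T0 : T 0 = 1.
Proof. exact: big_ord0. Qed.

Let T_sqr m : T m * T m = 1.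
Proof.
elim: m => [|m IH]; first by rewrite T0 mulr1.
by rewrite TS mulrACA IH s_sqr mulr1.
Qed.

Let TDk m : T (m + k) = T k * T m.
Proof.
elim: m => [|m IH]; first by rewrite T0 mulr1.
by rewrite addSn !TS IH oDk mulrA.
Qed.

Lemma partial_sign_full : T k = \prod_i s i.
Proof. by apply: eq_bigr => i _; rewrite o_val. Qed.

Lemma mul_cycle_mx (y : 'rV_k) (i : 'I_k) :
  (y *m cycle_mx) 0 (ordS i) = y 0 i * s i - y 0 (ordS (ordS i)) * s (ordS i).
Proof.
rewrite mxE; under eq_bigr => j _ do rewrite mxE mulrBr.
rewrite sumrB; congr (_ - _).
  rewrite (bigD1 i) //= eqxx mul1r big1 ?addr0 // => j ji.
  by rewrite (inj_eq (@ordS_inj k)) eq_sym (negPf ji) mul0r mulr0.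
rewrite (bigD1 (ordS (ordS i))) //= eqxx mul1r big1 ?addr0 // => j ji.
by rewrite (negPf ji) mul0r mulr0.
Qed.

(** The equation at position [m.+1] involves only the positions [m] and [m.+2]. Multiplied by
    [T m.+1] it loses its signs, as they square to 1, and says that the rescaled vector [y * T] is
    2-periodic. *)
Lemma cycle_mx_kerP (y : 'rV_k) :
  reflect (forall m, y 0 (o m.+2) * T m.+2 = y 0 (o m) * T m) (y *m cycle_mx == 0).
Proof.
have step m : (y *m cycle_mx) 0 (o m.+1) * T m.+1 =
    y 0 (o m) * T m - y 0 (o m.+2) * T m.+2.
  rewrite -oS mul_cycle_mx !oS !TS mulrBl.
  congr (_ - _); last by ring.
  by rewrite mulrACA s_sqr mulr1.
apply: (iffP eqP) => [y0 m|H].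
  by apply/eqP; rewrite eq_sym -subr_eq0 -step y0 mxE mul0r.
apply/rowP=> j; rewrite [RHS]mxE.
(* Position [j] as a successor: its predecessor is written [j + k.-1] so that [j = 0] needs no
   separate treatment. *)
have -> : j = o (j + k.-1).+1 by rewrite -addnS prednK // oDk o_val.
apply: (@mulIf _ (T (j + k.-1).+1)); last by rewrite mul0r step H subrr.
by apply: contra_eq_neq (T_sqr (j + k.-1).+1) => ->; rewrite mul0r eq_sym oner_eq0.
Qed.

(** The kernel always lies in the span of [r false] and [r true]; both belong to it when [k] is even
    and the signs multiply to 1. *)
Let r b : 'rV[R]_k := \row_i ((odd i == b)%:R * T i).

Let ker_parity (y : 'rV_k) : y *m cycle_mx = 0 ->
  forall m, y 0 (o m) * T m = if odd m then y 0 (o 1) * T 1 else y 0 (o 0) * T 0.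
Proof.
move/eqP/cycle_mx_kerP => H m; elim/ltn_ind: m => -[//|[//|m]] IH.
by rewrite H IH //= negbK.
Qed.

Let ker_span (y : 'rV_k) : y *m cycle_mx = 0 ->
  y = (y 0 (o 0) * T 0) *: r false + (y 0 (o 1) * T 1) *: r true.
Proof.
move=> y0; apply/rowP=> i; have := ker_parity y0 i; rewrite o_val => yi.
rewrite [LHS](_ : _ = y 0 i * T i * T i); last by rewrite -mulrA T_sqr mulr1.
by rewrite yi !mxE; case: (odd i); rewrite /= !mul0r !mul1r mulr0 ?add0r ?addr0.
Qed.

(** A skew-symmetric matrix of odd order is singular. Conversely, one turn around an odd cycle
    exchanges the two parities, so one rescaled value determines the other and the kernel is at most
    a line. *)
Lemma rank_cycle_odd : odd k -> \rank cycle_mx = k.-1.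
Proof.
move=> ok; apply/eqP; rewrite eqn_leq; apply/andP; split.
  have: \det cycle_mx = 0.
    have tr : cycle_mx^T = - cycle_mx by apply/matrixP=> i j; rewrite !mxE opprB.
    have := det_tr cycle_mx; rewrite tr -scaleN1r detZ -signr_odd ok expr1 mulN1r.
    by move/eqP; rewrite -subr_eq0 -opprD oppr_eq0 -mulr2n mulrn_eq0 => /eqP.
  move=> d0; rewrite -ltnS prednK // ltnNge; apply/negP=> le.
  have : cycle_mx \in unitmx by rewrite -row_free_unit /row_free eqn_leq rank_leq_row le.
  by rewrite unitmxE d0 unitr0.
have : (kermx cycle_mx <= (r false + T k *: r true)%R)%MS.
  apply/row_subP=> i; set y := row i _.
  have y0 : y *m cycle_mx = 0 by rewrite -row_mul mulmx_ker row0.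
  have h : y 0 (o 1) * T 1 = T k * (y 0 (o 0) * T 0).
    have kp := ker_parity y0 (0 + k).
    by rewrite oDk TDk oddD ok mulrCA /= in kp.
  rewrite (ker_span y0) h; set a := y 0 _ * T 0.
  by rewrite [T k * a]mulrC -(scalerA a (T k)) -scalerDr scalemx_sub.
move=> /mxrankS; rewrite mxrank_ker => /leq_trans/(_ (rank_leq_row _)).
lia.
Qed.

(** One turn around an even cycle keeps the parity and multiplies [T] by [T k]. If [T k] is not 1,
    this forces the kernel to be zero. *)
Let ker_even (y : 'rV_k) : ~~ odd k -> y *m cycle_mx = 0 ->
  forall m, y 0 (o m) * T m = T k * (y 0 (o m) * T m).
Proof.
move=> ek y0 m; have := ker_parity y0 (m + k).
by rewrite oddD (negPf ek) addbF -(ker_parity y0 m) oDk TDk mulrCA.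
Qed.

Lemma rank_cycle_even_neg : ~~ odd k -> \prod_i s i != 1 -> \rank cycle_mx = k.
Proof.
rewrite -partial_sign_full => ek Tk.
have Z x : x = T k * x -> x = 0.
  move/eqP; rewrite -[X in X == _]mul1r -subr_eq0 -mulrBl mulf_eq0 subr_eq0 eq_sym (negPf Tk).
  by move/eqP.
suff : kermx cycle_mx == 0 by rewrite kermx_eq0 => /eqP.
rewrite -submx0; apply/row_subP=> i; set y := row i _.
have y0 : y *m cycle_mx = 0 by rewrite -row_mul mulmx_ker row0.
by rewrite (ker_span y0) !(Z _ (ker_even ek y0 _)) !scale0r addr0 sub0mx.
Qed.

Lemma rank_cycle_even_pos : ~~ odd k -> \prod_i s i = 1 -> \rank cycle_mx = (k - 2)%N.
Proof.
rewrite -partial_sign_full => ek Tk.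
(* Reducing the index modulo [k] preserves this formula because [k] is even and [T k = 1]. *)
have rE b m : r b 0 (o m) = (odd m == b)%:R * T m.
  elim/ltn_ind: m => m IH; have [mk|km] := ltnP m k; first by rewrite mxE /= modn_small.
  rewrite -(subnK km) oDk IH; last by rewrite ltn_subrL k_gt0 (leq_trans k_gt0).
  by rewrite oddD (negPf ek) addbF TDk Tk mul1r.
have rK b : (r b <= kermx cycle_mx)%MS.
  apply/sub_kermxP/eqP/cycle_mx_kerP => m.
  by rewrite !rE /= negbK -!mulrA !T_sqr.
have r0 b : r b 0 (o b) != 0.
  rewrite rE; have -> : (odd b == b) by case: (b).
  by rewrite mul1r; apply: contra_eq_neq (T_sqr b) => ->; rewrite mul0r eq_sym oner_eq0.
have rN b : r b 0 (o (~~ b)) = 0 by rewrite rE; case: (b); rewrite /= mul0r.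
have cap : (r false :&: r true)%MS = 0.
  apply/eqP; rewrite -submx0; apply/row_subP=> i; set x := row i _.
  have /sub_rVP[a xr] : (x <= r false)%MS by rewrite (submx_trans (row_sub _ _)) // capmxSl.
  have /sub_rVP[b xd] : (x <= r true)%MS by rewrite (submx_trans (row_sub _ _)) // capmxSr.
  have : x 0 (o 0) = 0 by rewrite xd mxE (rN true) mulr0.
  move/eqP; rewrite xr mxE mulf_eq0 (negPf (r0 false)) orbF => /eqP->.
  by rewrite scale0r sub0mx.
have rk : \rank (r false + r true)%MS = 2.
  have nz b : r b != 0 by apply: contraNneq (r0 b) => ->; rewrite mxE.
  by rewrite mxrank_disjoint_sum // !rank_rV !nz.
have eqK : (kermx cycle_mx == r false + r true)%MS.
  rewrite addsmx_sub !rK !andbT; apply/row_subP=> i; set y := row i _.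
  have y0 : y *m cycle_mx = 0 by rewrite -row_mul mulmx_ker row0.
  rewrite (ker_span y0) addmx_sub // scalemx_sub //; [exact: addsmxSl | exact: addsmxSr].
have := rank_leq_row cycle_mx; have := mxrank_ker cycle_mx.
rewrite (eqmxP eqK) rk; lia.
Qed.

End CycleRank.

(** * Matchings of a cycle *)

(** The successor of the last index is 0. The last index is odd for even [k], so the parity flips
    there too; for odd [k] it is even and this single flip fails. *)
Lemma odd_ordS k (i : 'I_k) :
  odd (ordS i) = ~~ odd i && (odd k ==> (i.+1 < k)).
Proof.
have := ltn_ord i; rewrite /= leq_eqVlt => /orP[/eqP eq|lt].
  by rewrite eq modnn ltnn -[in odd k]eq /=; case: (odd i).
by rewrite modn_small // lt implybT andbT.
Qed.

Lemma ordS_neq k (i j : 'I_k) : 2 < k -> i = ordS j -> j <> ordS i.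
Proof.
move=> k3 /(congr1 val) /= ij /(congr1 val) /= ji; move: ij ji.
have := ltn_ord i; rewrite leq_eqVlt => /orP[/eqP ik|ik];
  have := ltn_ord j; rewrite leq_eqVlt => /orP[/eqP jk|jk];
  rewrite ?ik ?jk ?modnn ?(modn_small ik) ?(modn_small jk); lia.
Qed.

Lemma card_odd_ord k : #|[set i : 'I_k | odd i]| = k./2.
Proof.
rewrite cardsE -sum1_card big_mkcond /=.
elim: k => [|k IH]; first by rewrite big_ord0.
rewrite big_ord_recr /= IH uphalf_half addnC.
by rewrite unfold_in /=; case: (odd k).
Qed.

Section Cycle.
Variables (V : finType) (arc : rel V) (c : seq V).
Hypothesis cyc : is_cycle arc c.
Let k := size c.
Let k3 : 2 < k. Proof. by case/and3P: cyc. Qed.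
Let uc : uniq c. Proof. by case/and3P: cyc. Qed.

Definition vtx (i : 'I_k) : V := tnth (in_tuple c) i.
Local Notation X := vtx.

Lemma vtx_inj : injective X.
Proof. exact/tuple_uniqP. Qed.

Lemma vtxP x : reflect (exists i, x = X i) (x \in c).
Proof. exact: (@tnthP _ _ (in_tuple c)). Qed.

Lemma vtx_in i : X i \in c.
Proof. by apply/vtxP; exists i. Qed.

Lemma next_vtx i : next c (X i) = X (ordS i).
Proof.
rewrite next_nth vtx_in.
have x0 : V := X i.
rewrite {1}/X (tnth_nth x0) /=; move: uc (ltn_ord i); rewrite /X !(tnth_nth x0) /= {1 2}/k.
move=> u lt; rewrite index_uniq //.
have -> : i.+1 %% size c = if i.+1 < size c then i.+1 else 0.
  case: ltnP => [/modn_small//|ge]; suff -> : i.+1 = size c by rewrite modnn.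
  by apply/eqP; rewrite eqn_leq lt.
move: (nat_of_ord i) lt => m; case: (c) => // y p /=; rewrite ltnS => lt.
(* At the last position [nth] runs out of range and returns its default, the head [y], as the cyclic
   successor should be. *)
case: ltnP => [h|h]; last by rewrite nth_default.
by apply: set_nth_default.
Qed.

Lemma vtx_adj i : adj arc (X i) (X (ordS i)).
Proof. by rewrite -next_vtx next_cycle ?vtx_in //; case/and3P: cyc. Qed.

Definition cyc_edge i : {set V} := [set X i; X (ordS i)].
Local Notation e := cyc_edge.

Lemma mem_cyc_edge i j : (X i \in e j) = (i == j) || (i == ordS j).
Proof. by rewrite !inE !(inj_eq vtx_inj). Qed.

Lemma cyc_edge_inj : injective e.
Proof.
move=> i j eij; have := set21 (X i) (X (ordS i)); rewrite -/(e i) eij mem_cyc_edge.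
case/orP=> /eqP // ij; have := set21 (X j) (X (ordS j)); rewrite -/(e j) -eij mem_cyc_edge.
by case/orP=> /eqP // ji; case: (ordS_neq k3 ij ji).
Qed.

Lemma cyc_edgesP f : reflect (exists i, f = e i) (f \in cycle_edges c).
Proof.
apply: (iffP (cycle_edgesP _ _)) => [[x /vtxP[i ->] ->]|[i ->]].
  by exists i; rewrite next_vtx.
by exists (X i); rewrite ?vtx_in // next_vtx.
Qed.

Lemma cyc_edge_is_edge i : is_edge arc (e i).
Proof. by apply/is_edgeP; exists (X i), (X (ordS i)); rewrite vtx_adj. Qed.

(** For even [k] these are the two perfect matchings of the cycle. For odd [k] the class [false] has
    two edges at vertex 0, and only the class [true] is a matching. *)
Definition alt_edges b := [set e i | i in [set i : 'I_k | odd i == b]].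

Lemma alt_edgesP b f : reflect (exists2 i : 'I_k, odd i = b & f = e i) (f \in alt_edges b).
Proof.
apply: (iffP imsetP) => [[i]|[i ib ->]].
  by rewrite inE => /eqP ib ->; exists i.
by exists i; rewrite ?inE ?ib.
Qed.

Lemma alt_edges_sub b x f : f \in alt_edges b -> x \in f -> x \in c.
Proof. by case/alt_edgesP=> i _ ->; rewrite !inE => /orP[] /eqP->; apply: vtx_in. Qed.

Lemma matching_alt b : b || ~~ odd k -> matching arc (alt_edges b).
Proof.
move=> bk; apply/matchingP; split.
  by move=> f /alt_edgesP[i _ ->]; apply: cyc_edge_is_edge.
have par (i j : 'I_k) : odd i = b -> odd j = b -> i != ordS j.
  move=> ib jb; apply: contraTneq bk => /(congr1 (fun i : 'I_k => odd i)).
  by rewrite odd_ordS ib jb; case: (b); case: (odd k).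
move=> _ _ /alt_edgesP[i ib ->] /alt_edgesP[j jb ->] x xi xj.
have [l xl] : exists l, x = X l.
  by apply/vtxP; move: xi; rewrite !inE => /orP[] /eqP ->; apply: vtx_in.
move: xi xj; rewrite xl !mem_cyc_edge => /orP[] /eqP -> /orP[] /eqP.
- by move->.
- by move=> ij; have := par i j ib jb; rewrite ij eqxx.
- by move=> ij; have := par j i jb ib; rewrite ij eqxx.
- by move/ordS_inj->.
Qed.

Lemma card_alt_edges b : b || ~~ odd k -> #|alt_edges b| = k./2.
Proof.
rewrite card_imset; last exact: cyc_edge_inj.
case: b => [_|/= ek].
  by rewrite -card_odd_ord; congr #|pred_of_set _|; apply/setP=> i; rewrite !inE eqb_id.
have := cardsC [set i : 'I_k | odd i]; rewrite card_odd_ord card_ord.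
have -> : ~: [set i : 'I_k | odd i] = [set i : 'I_k | odd i == false].
  by apply/setP=> i; rewrite !inE eqbF_neg.
move=> h; apply: (@addnI k./2).
by rewrite [LHS]h addnn -[LHS]odd_double_half (negPf ek).
Qed.

Lemma half_leq_matching_number : k./2 <= matching_number arc.
Proof.
by rewrite -(@card_alt_edges true) //; apply/leq_matching_number/matching_alt.
Qed.

(** * Maximum matchings containing a perfect matching of an even cycle *)

Section Even.
Hypothesis ek : ~~ odd k.

Let m_alt b : matching arc (alt_edges b).
Proof. by apply: matching_alt; rewrite ek orbT. Qed.
Let c_alt b : #|alt_edges b| = k./2.
Proof. by apply: card_alt_edges; rewrite ek orbT. Qed.

Lemma alt_edges_cover b x : x \in c -> exists2 f, f \in alt_edges b & x \in f.
Proof.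
case/vtxP=> i ->; have [ib|ib] := eqVneq (odd i) b.
  by exists (e i); [apply/alt_edgesP; exists i | rewrite set21].
have [j iE] : exists j, i = ordS j by exists (ord_pred i); rewrite ord_predK.
exists (e j); last by rewrite iE set22.
apply/alt_edgesP; exists j => //; move: ib; rewrite iE odd_ordS (negPf ek) andbT.
by case: (odd j); case: (b).
Qed.

Lemma alt_edges_disjoint f : f \in alt_edges false -> f \in alt_edges true -> False.
Proof.
by case/alt_edgesP=> i oi -> /alt_edgesP[j oj /cyc_edge_inj ij]; rewrite ij oj in oi.
Qed.

Let b0 := matching_number arc.
Let D := [set M : {set {set V}} | [&& matching arc M,
        [forall e in M, [disjoint e & [set x in c]]] & #|M| == b0 - k./2]].
Let MAX := [set M : {set {set V}} | matching arc M & #|M| == b0].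

(** A perfect matching of the cycle covers all its vertices, so the remaining edges of the matching
    avoid the cycle; conversely the union with any matching off the cycle is again a matching. *)
Lemma maximum_with_alt b :
  [set M in MAX | alt_edges b \subset M] = [set alt_edges b :|: N | N in D].
Proof.
apply/setP=> M; apply/idP/imsetP => [|[N]].
  rewrite !inE -andbA => /and3P[mM /eqP sM sub].
  have [_ dj] := matchingP _ _ mM.
  exists (M :\: alt_edges b); last by rewrite setDE setUIr setUCr setIT (setUidPr sub).
  rewrite inE (matching_sub (subsetDl _ _) mM) cardsD (setIidPr sub) c_alt sM eqxx andbT.
  apply/forall_inP=> f; rewrite inE => /andP[fE fM].
  rewrite disjoint_subset; apply/subsetP=> x xf; rewrite !inE.
  apply: contra fE => /(alt_edges_cover b)[g gE xg].
  by rewrite (dj f g fM (subsetP sub _ gE) x).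
move=> ND ->; move: ND; rewrite [N \in D]inE => /and3P[mN /forall_inP dN /eqP sN].
have [ed dj] := matchingP _ _ mN; have [ed' dj'] := matchingP _ _ (m_alt b).
have dis f g x : f \in alt_edges b -> g \in N -> x \in f -> x \in g -> False.
  move=> fE gN xf xg; have := disjointFr (dN g gN) xg.
  by rewrite inE (alt_edges_sub fE xf).
rewrite !inE subsetUl andbT; apply/andP; split.
  apply/matchingP; split; first by move=> f; rewrite inE => /orP[/ed'|/ed].
  move=> f g; rewrite !inE => /orP[fE|fN] /orP[gE|gN] x xf xg.
  - exact: dj' fE gE x xf xg.
  - by case: (dis f g x).
  - by case: (dis g f x).
  - exact: dj fN gN x xf xg.
rewrite cardsU c_alt sN.
have -> : alt_edges b :&: N = set0.
  apply/setP=> f; rewrite !inE; apply/negP=> /andP[fE fN].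
  by case/alt_edgesP: (fE) => i _ fe; apply: (dis f f (X i)); rewrite // fe set21.
by rewrite cards0 subn0 subnKC ?half_leq_matching_number.
Qed.

Lemma card_maximum_with_alt b : #|[set M in MAX | alt_edges b \subset M]| = #|D|.
Proof.
rewrite maximum_with_alt card_in_imset // => N1 N2.
have key N : N \in D -> (alt_edges b :|: N) :\: alt_edges b = N.
  rewrite [N \in D]inE => /and3P[mN /forall_inP dN _].
  rewrite setDUl setDv set0U; apply/setDidPl; rewrite disjoint_subset.
  apply/subsetP=> f fN; rewrite inE; apply/negP=> /alt_edgesP[i _ fe].
  have := disjointFr (dN f fN); rewrite fe => /(_ _ (set21 _ _)).
  by rewrite inE vtx_in.
by move=> N1D N2D E12; rewrite -(key _ N1D) E12 key.
Qed.

(** The maximum matchings containing a perfect matching of the cycle form a subset [A] of [MAX],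
    made of two disjoint families of size [#|D|]. Equality of cardinals then means [A = MAX]. *)
Lemma count_maximum_forced :
  (num_matchings arc b0 == 2 * num_matchings_del arc [set x in c] (b0 - k./2)) =
  maximum_forced arc (alt_edges false) (alt_edges true).
Proof.
rewrite /num_matchings /num_matchings_del -/D -/MAX.
set A := [set M in MAX | alt_edges false \subset M] :|:
         [set M in MAX | alt_edges true \subset M].
have cA : #|A| = 2 * #|D|.
  rewrite /A cardsU !card_maximum_with_alt.
  suff -> : [set M in MAX | alt_edges false \subset M] :&:
            [set M in MAX | alt_edges true \subset M] = set0.
    by rewrite cards0 subn0 mul2n addnn.
  (* A matching containing both classes would have two distinct edges at vertex 0. *)
  apply/setP=> M; rewrite !inE; apply/negP=> /andP[].
  move=> /andP[/andP[mM _] /subsetP s0] /andP[_ /subsetP s1].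
  have [_ dj] := matchingP _ _ mM.
  have k_gt0 : 0 < k by apply: leq_trans k3.
  have [f fE xf] := alt_edges_cover false (vtx_in (Ordinal k_gt0)).
  have [g gE xg] := alt_edges_cover true (vtx_in (Ordinal k_gt0)).
  have fg := dj f g (s0 _ fE) (s1 _ gE) _ xf xg.
  by rewrite -fg in gE; apply: alt_edges_disjoint fE gE.
have sA : A \subset MAX by apply/subsetP=> M; rewrite !inE => /orP[] /andP[].
rewrite -cA eq_sym (subset_leqif_cards sA) eqEsubset sA /=.
apply/subsetP/forallP => [H M|H M].
  apply/implyP=> mM; have := H M; rewrite !inE mM => /(_ isT).
  by rewrite !andTb.
by rewrite !inE => mM; have := H M; rewrite mM.
Qed.

End Even.

(** * Matchings when every edge lies on the cycle *)

Section CycleOnly.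
Hypothesis only : forall u v, adj arc u v -> [set u; v] \in cycle_edges c.

Lemma cycle_only_edge M f : matching arc M -> f \in M -> exists i, f = e i.
Proof.
move=> mM fM; have [ed _] := matchingP _ _ mM.
by have /is_edgeP[u [v [uv ->]]] := ed f fM; apply/cyc_edgesP/only.
Qed.

Let I (M : {set {set V}}) := [set i | e i \in M].

Let cardI M : matching arc M -> #|M| = #|I M|.
Proof.
move=> mM; rewrite -(card_imset _ cyc_edge_inj); congr #|pred_of_set _|.
apply/setP=> f; apply/idP/imsetP => [fM|[i]]; last by rewrite inE => h ->.
by have [i fe] := cycle_only_edge mM fM; exists i; rewrite ?inE -?fe.
Qed.

(** Consecutive cycle edges share a vertex. Disjointness from the shifted index set bounds twice the
    size of a matching by [k]. *)
Let I_dis M : matching arc M -> [disjoint I M & [set ordS i | i in I M]].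
Proof.
move=> mM; have [_ dj] := matchingP _ _ mM.
rewrite disjoint_subset; apply/subsetP=> i; rewrite !inE => iM.
apply/negP=> /imsetP[j]; rewrite inE => jM ij.
have /cyc_edge_inj ij' : e i = e j.
  by apply: (dj _ _ iM jM (X i)); rewrite mem_cyc_edge ?eqxx // ij eqxx orbT.
have ii : i = ordS i by rewrite {2}ij'.
exact: (ordS_neq k3 ii ii).
Qed.

Let cardIS M : #|[set ordS i | i in I M]| = #|I M|.
Proof. by rewrite card_imset //; exact: ordS_inj. Qed.

Lemma matching_number_cycle : matching_number arc = k./2.
Proof.
apply/eqP; rewrite eqn_leq half_leq_matching_number andbT.
have [M mM <-] := ex_maximum_matching arc.
rewrite cardI // -(doubleK #|I M|) half_leq // -addnn -{2}cardIS.
have := I_dis mM; rewrite -setI_eq0 => /eqP d0.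
by rewrite -[_ + _]subn0 -(@cards0 'I_k) -d0 -cardsU -[k in _ <= k]card_ord max_card.
Qed.

(** A matching of size [k./2] and its shift fill all of ['I_k] when [k] is even, so membership
    alternates along the cycle and the matching contains a full parity class. *)
Lemma maximum_forced_cycle : ~~ odd k ->
  maximum_forced arc (alt_edges false) (alt_edges true).
Proof.
move=> ek; apply/forallP=> M; apply/implyP=> /andP[mM /eqP sM].
have IS i : (ordS i \in I M) = (i \notin I M).
  have d0 := I_dis mM.
  have full : I M :|: [set ordS i | i in I M] = setT.
    apply/eqP; rewrite eqEcard subsetT cardsT card_ord cardsU.
    move: d0; rewrite -setI_eq0 => /eqP->; rewrite cards0 subn0 cardIS -cardI // sM.
    rewrite matching_number_cycle; have := odd_double_half k; rewrite (negPf ek); lia.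
  have /setP/(_ (ordS i)) := full; rewrite in_setU in_setT.
  have -> : (ordS i \in [set ordS i | i in I M]) = (i \in I M).
    by rewrite mem_imset //; exact: ordS_inj.
  have [iM _|iM] := boolP (i \in I M); last by rewrite orbF.
  exact: (disjointFl d0 (imset_f _ iM)).
have k_gt0 : 0 < k by apply: leq_trans k3.
pose o m := Ordinal (ltn_pmod m k_gt0).
have par m : (o m \in I M) = odd m (+) (o 0 \in I M).
  elim: m => [//|m IH].
  have -> : o m.+1 = ordS (o m) by apply: val_inj; rewrite /= -addn1 -modnDml addn1.
  by rewrite IS IH /= addNb.
have ov (i : 'I_k) : o i = i by apply: val_inj; rewrite /= modn_small.
suff : alt_edges (o 0 \notin I M) \subset M by case: (_ \notin _) => ->; rewrite ?orbT.
apply/subsetP=> f /alt_edgesP[i ib ->].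
have : i \in I M by rewrite -(ov i) par ib; case: (_ \in _).
by rewrite inE.
Qed.

End CycleOnly.
End Cycle.

(** * Reduction to the bare cycle *)

Section CycleOnlyRank.
Local Open Scope ring_scope.
Variables (R : realFieldType) (V : finType) (arc : rel V) (c : seq V).
Hypothesis ori : oriented arc.
Hypothesis cyc : is_cycle arc c.
Let k := size c.
Local Notation X := (@vtx V c).

Let k3 : (2 < k)%N. Proof. by case/and3P: cyc. Qed.

Lemma cycle_sign_vtx :
  cycle_sign arc c = \prod_(i < k) skew_entry arc int (X i) (X (ordS i)).
Proof.
rewrite /cycle_sign big_tnth; apply: eq_bigr => i _.
by rewrite (next_vtx cyc).
Qed.

Definition cycle_entry (i : 'I_k) : R := skew_entry arc R (X i) (X (ordS i)).

Lemma cycle_entry_sqr i : cycle_entry i * cycle_entry i = 1.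
Proof. exact/skew_entry_sqr/vtx_adj. Qed.

(** The sign is an integer of square 1, so being positive means being 1, and this can be tested in
    [R]. *)
Lemma evenly_orientedE : evenly_oriented arc c = (\prod_i cycle_entry i == 1).
Proof.
have -> : \prod_i cycle_entry i = (cycle_sign arc c)%:~R.
  rewrite cycle_sign_vtx rmorph_prod; apply: eq_bigr => i _.
  by rewrite /cycle_entry /skew_entry; case: ifP => // _; case: ifP => // _; rewrite rmorphN1.
rewrite -[X in _ == X](mulr1z 1) eqr_int /evenly_oriented.
have : cycle_sign arc c * cycle_sign arc c == 1.
  rewrite cycle_sign_vtx -big_split big1 //= => i _.
  have := vtx_adj cyc i; rewrite /adj /skew_entry.
  by case: (arc _ _) => //= ->.
by rewrite -expr2 sqrf_eq1 => /orP[] /eqP->.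
Qed.

Hypothesis only : forall u v, adj arc u v -> [set u; v] \in cycle_edges c.

Let B : 'M[R]_k := \matrix_(i, j) skew_entry arc R (X i) (X j).

Let B_cycle_mx : B = cycle_mx cycle_entry.
Proof.
apply/matrixP=> i j; rewrite !mxE.
have [jE|jN] := eqVneq j (ordS i).
  have -> : (i == ordS j) = false by apply/eqP=> /(ordS_neq k3); rewrite -jE.
  by rewrite mul1r mul0r subr0 jE.
have [iE|iN] := eqVneq i (ordS j).
  by rewrite mul1r mul0r sub0r /cycle_entry -iE skew_entryC.
rewrite !mul0r subr0; apply/eqP; rewrite skew_entry_eq0; apply/negP=> ij.
have ijN : i != j by apply: contraTneq ij => ->; rewrite oriented_irr.
have /(cyc_edgesP cyc)[l lE] := only ij.
have := set21 (X i) (X j); rewrite lE (mem_cyc_edge cyc).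
have := set22 (X i) (X j); rewrite lE (mem_cyc_edge cyc).
by case/orP=> /eqP jl /orP[] /eqP il; move: ijN jN iN; rewrite jl il ?eqxx.
Qed.

(** [P] selects the cycle vertices in cyclic order, so [B = P S P^T]. Vertices off the cycle are
    isolated, hence also [S = P^T B P], and the ranks agree. *)
Lemma skew_rank_cycle_only : skew_rank arc R = \rank (cycle_mx cycle_entry).
Proof.
rewrite /skew_rank -B_cycle_mx; set S := skew_adj arc R.
pose P : 'M[R]_(k, #|V|) := \matrix_(i, j) (X i == enum_val j)%:R.
have Pu i u : P i u = (u == enum_rank (X i))%:R.
  by rewrite mxE -(inj_eq enum_val_inj) enum_rankK eq_sym.
have PM n (M : 'M_(_, n)) i v : (P *m M) i v = M (enum_rank (X i)) v.
  rewrite mxE (bigD1 (enum_rank (X i))) //= Pu eqxx mul1r big1 ?addr0 // => u un.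
  by rewrite Pu (negPf un) mul0r.
have St : S^T = - S by apply/matrixP=> u v; rewrite !mxE skew_entryC.
have BE : B = P *m (S *m P^T).
  apply/matrixP=> i j; rewrite PM -[S *m P^T]trmxK trmx_mul trmxK St mulmxN.
  by rewrite [RHS]mxE [RHS]mxE PM !mxE !enum_rankK -skew_entryC.
have PS : P^T *m (P *m S) = S.
  apply/matrixP=> u v; rewrite mxE.
  have [/(vtxP)[i uE]|uN] := boolP (enum_val u \in c).
    have ui : u = enum_rank (X i) by rewrite -uE enum_valK.
    rewrite (bigD1 i) //= PM mxE Pu -ui eqxx mul1r big1 ?addr0 // => j ji.
    rewrite mxE Pu ui (inj_eq enum_rank_inj) (inj_eq (vtx_inj cyc)) eq_sym (negPf ji).
    exact: mul0r.
  rewrite big1 => [|i _].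
    rewrite mxE; apply/esym/eqP; rewrite skew_entry_eq0; apply: contra uN => /only h.
    exact: cycle_edge_sub h (set21 _ _).
  rewrite mxE Pu; case: eqP => [ui|]; last by rewrite mul0r.
  by move: uN; rewrite ui enum_rankK vtx_in.
have SP : S *m P^T *m P = S.
  by apply: trmx_inj; rewrite !trmx_mul trmxK St !mulmxN PS.
have SB : S = P^T *m (B *m P) by rewrite BE -[P *m _ *m P]mulmxA SP PS.
apply/eqP; rewrite eqn_leq; apply/andP; split.
  by rewrite SB (leq_trans (mxrankM_maxr _ _)) // mxrankM_maxl.
by rewrite BE (leq_trans (mxrankM_maxr _ _)) // mxrankM_maxl.
Qed.

Lemma skew_rank_cycle :
  (skew_rank arc R + (if ~~ odd k && evenly_oriented arc c then 2 else 0) = (k./2).*2)%N.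
Proof.
have k2 : (1 < k)%N by apply: ltnW.
rewrite skew_rank_cycle_only; have := odd_double_half k.
case ok: (odd k) => /=.
  by rewrite (rank_cycle_odd k2 cycle_entry_sqr ok) addn0 => {1}<-.
rewrite evenly_orientedE add0n => ->; case: eqP => [h|/eqP h].
  by rewrite (rank_cycle_even_pos k2 cycle_entry_sqr (negbT ok) h) subnK.
by rewrite (rank_cycle_even_neg k2 cycle_entry_sqr (negbT ok) h) addn0.
Qed.

End CycleOnlyRank.

(** * Induction on the number of arcs *)

Section Induction.
Variables (R : realFieldType) (V : finType).
Implicit Types (arc : rel V) (c : seq V).

Definition num_arcs arc := #|[set p : V * V | arc p.1 p.2]|.

Lemma num_arcs_del arc v u : leaf arc v u -> num_arcs (del_vertex arc u) < num_arcs arc.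
Proof.
move=> lf; have vu : adj arc v u by rewrite (leaf_adj _ lf).
rewrite proper_card // properE; apply/andP; split.
  by apply/subsetP=> [[a b]]; rewrite !inE => /and3P[].
apply/subsetPn; case/orP: vu => h; [exists (v, u)|exists (u, v)];
  by rewrite ?inE // /del_vertex /= eqxx ?andbF.
Qed.

Lemma cycle_del arc u c : is_cycle (del_vertex arc u) c = is_cycle arc c && (u \notin c).
Proof.
apply/idP/andP=> [/and3P[Uc sc cc]|[/and3P[Uc sc cc] uc]].
  split.
    apply/and3P; split=> //; apply: sub_cycle cc => a b.
    by rewrite adj_del => /and3P[].
  by apply/negP=> /(next_cycle cc); rewrite adj_del eqxx andbF.
apply/and3P; split=> //; apply: (sub_in_cycle (P := mem c)) cc; last exact/allP.
move=> a b ac bc ab; rewrite adj_del ab /=.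
by apply/andP; split; apply: contraNneq uc => <-.
Qed.

Lemma skew_rank_forest arc : oriented arc -> (forall c, ~~ is_cycle arc c) ->
  skew_rank arc R = (matching_number arc).*2.
Proof.
have [n] := ubnP (num_arcs arc); elim: n arc => // n IH arc le ori nc.
have irr := oriented_irr ori.
have [/existsP[u /existsP[v uv]]|/existsPn no] := boolP [exists u, exists v, adj arc u v].
  (* Without cycles the condition on the common edge set is vacuous, so the empty set serves and any
     edge lies off it. *)
  have [] := @exists_leaf _ _ irr set0 u v _ uv; first by move=> c; rewrite (negPf (nc c)).
    by rewrite inE.
  move=> {uv u v} v [u lf].
  rewrite (skew_rank_leaf R ori lf) (matching_number_leaf lf) IH //.
  - by apply: leq_trans (num_arcs_del lf) _.
  - exact: oriented_del.
  - by move=> c; rewrite cycle_del negb_and nc.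
have na u v : ~~ adj arc u v by move: (no u) => /existsPn.
have -> : matching_number arc = 0.
  have [M mM <-] := ex_maximum_matching arc; apply/eqP; rewrite cards_eq0.
  apply/eqP/setP=> e; rewrite inE; apply/negP=> eM; have [ed _] := matchingP _ _ mM.
  by have /is_edgeP[u [v [uv _]]] := ed e eM; have := na u v; rewrite uv.
rewrite /skew_rank (_ : skew_adj _ _ = 0%R) ?mxrank0 //.
by apply/matrixP=> i j; rewrite !mxE; apply/eqP; rewrite skew_entry_eq0.
Qed.

Lemma evenly_oriented_del arc u c : is_cycle arc c -> u \notin c ->
  evenly_oriented (del_vertex arc u) c = evenly_oriented arc c.
Proof.
move=> cc uc; rewrite /evenly_oriented /cycle_sign; congr (_ < _)%R.
rewrite big_seq [RHS]big_seq; apply: eq_bigr => x xc.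
rewrite /skew_entry /del_vertex.
have -> : x != u by apply: contraNneq uc => <-.
have -> : next c x != u by apply: contraNneq uc => <-; rewrite mem_next.
by rewrite !andbT.
Qed.

(** Equality of the edge sets of all cycles passes to subgraphs, which suits the induction. The
    correction is added on the left to avoid truncated subtraction. *)
Lemma skew_rank_unicyclic arc c : oriented arc -> is_cycle arc c ->
  (forall c', is_cycle arc c' -> cycle_edges c' = cycle_edges c) ->
  skew_rank arc R + (if [&& ~~ odd (size c), evenly_oriented arc c &
     maximum_forced arc (alt_edges c false) (alt_edges c true)] then 2 else 0) =
  (matching_number arc).*2.
Proof.
have [n] := ubnP (num_arcs arc); elim: n arc => // n IH arc le ori cc uniqc.
have irr := oriented_irr ori.
have [only|] := boolP [forall u, forall v, adj arc u v ==> ([set u; v] \in cycle_edges c)].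
  have {}only u v : adj arc u v -> [set u; v] \in cycle_edges c.
    by move: only => /forallP/(_ u)/forallP/(_ v)/implyP.
  rewrite (matching_number_cycle cc only) -(skew_rank_cycle R ori cc only).
  case ec: (~~ odd _) => //=.
  by rewrite (maximum_forced_cycle cc only ec) andbT.
move=> /forallPn[a /forallPn[b]]; rewrite negb_imply => /andP[ab abN].
have [v [u lf]] := exists_leaf irr uniqc ab abN.
have vc := leaf_notin_cycle lf cc.
rewrite (skew_rank_leaf R ori lf) (matching_number_leaf lf) doubleS.
have [uc|uc] := boolP (u \in c); last first.
  rewrite (maximum_forced_leaf lf); last first.
    move=> e; rewrite inE => eE; apply: contra uc.
    by case/orP: eE => /alt_edges_sub h /h.
  rewrite -(evenly_oriented_del cc uc) !addSn IH //.
  - exact: leq_trans (num_arcs_del lf) _.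
  - exact: oriented_del.
  - by rewrite cycle_del cc uc.
  - by move=> c'; rewrite cycle_del => /andP[/uniqc].
(* Now [u] is on the cycle: each of the two perfect matchings has an edge at [u], and it does not
   contain [v], which is off the cycle. *)
have -> : [&& ~~ odd (size c), evenly_oriented arc c
  & maximum_forced arc (alt_edges c false) (alt_edges c true)] = false.
  case ec: (odd _) => //=; apply/negbTE; rewrite negb_and; apply/orP; right.
  have [e0 e0E ue0] := alt_edges_cover (negbT ec) false uc.
  have [e1 e1E ue1] := alt_edges_cover (negbT ec) true uc.
  apply: (maximum_forced_stem lf e0E e1E) => //; apply: contra vc.
    exact: alt_edges_sub e0E.
  exact: alt_edges_sub e1E.
rewrite addn0 skew_rank_forest //; first exact: oriented_del.
(* A cycle of [G - u] would have the edges of [c], hence pass through [u]. *)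
move=> c'; rewrite cycle_del; apply/negP=> /andP[/uniqc ec uc'].
have := mem_cycle_edge uc; rewrite -ec => /cycle_edge_sub/(_ (set21 _ _)).
exact/negP.
Qed.

End Induction.

Theorem theorem4p2 (R : realFieldType) (V : finType) (arc : rel V) (c : seq V) :
  oriented arc -> unicyclic arc -> is_cycle arc c ->
  let k := size c in
  let beta := matching_number arc in
  skew_rank arc R =
    (if [&& ~~ odd k, evenly_oriented arc c &
            num_matchings arc beta ==
              2 * num_matchings_del arc [set x in c] (beta - k./2)]
     then beta.*2 - 2 else beta.*2).
Proof.
move=> ori [_ [c0 cc0 uni]] cc k beta.
have uniqc c' : is_cycle arc c' -> cycle_edges c' = cycle_edges c.
  by move=> /uni->; rewrite uni.
(* Replacing [beta.*2] by the rank plus its correction makes the subtraction of 2 exact. *)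
rewrite /beta -(skew_rank_unicyclic R ori cc uniqc).
case ek: (odd k) => /=; first by rewrite addn0.
rewrite (count_maximum_forced cc (negbT ek)).
by case: (_ && _); rewrite ?addn0 ?addnK.
Qed.
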